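(* Let $(A,B,{}_AM_B,{}_BN_A,\varphi,\phi)$ be a strict Morita context, let $S=\begin{pmatrix} A & M \\ N & B \end{pmatrix}$ be the associated Morita ring, and let $R=\begin{pmatrix} A & 0 \\ 0 & B \end{pmatrix}\subseteq S$. Then the extension $S/R$ is separable.
   Context: A strict Morita context $(A,B,{}_AM_B,{}_BN_A,\varphi,\phi)$ consists of unital (associative) rings $A$ and $B$, an $A$-$B$-bimodule $M$, a $B$-$A$-bimodule $N$, an $A$-$A$-bimodule epimorphism $\varphi:M\otimes_BN\to A$ and a $B$-$B$-bimodule epimorphism $\phi:N\otimes_AM\to B$, satisfying the usual Morita associativity conditions $\varphi(m\otimes n)m'=m\,\phi(n\otimes m')$ and $\phi(n\otimes m)n'=n\,\varphi(m\otimes n')$ for all $m,m'\in M$, $n,n'\in N$. The associated Morita ring is the set $S=\begin{pmatrix} A & M \\ N & B \end{pmatrix}$ of matrices with entries in the indicated sets, with entrywise addition and multiplication $$\begin{pmatrix} a_1 & m_1 \\ n_1 & b_1 \end{pmatrix}\begin{pmatrix} a_2 & m_2 \\ n_2 & b_2 \end{pmatrix}=\begin{pmatrix} a_1a_2+\varphi(m_1\otimes n_2) & a_1m_2+m_1b_2 \\ n_1a_2+b_1n_2 & \phi(n_1\otimes m_2)+b_1b_2 \end{pmatrix}.$$ Separability: $S/R$ is separable if there is $x\in S\otimes_RS$ with $m(x)=1$, where $m:S\otimes_RS\to S$ is the multiplication map, and $sx=xs$ for all $s\in S$. *)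

(* Defs.v *)
From HB Require Import structures.
From mathcomp Require Import all_boot all_algebra ring_quotient.
From mathcomp.multinomials Require Import freeg.
From mathcomp.classical Require Import boolp.

Set Implicit Arguments.
Unset Strict Implicit.
Unset Printing Implicit Defensive.

Import GRing.Theory.
Local Open Scope ring_scope.
Local Open Scope quotient_scope.

(* The left action is the library's *:, the right action is written x <*: b.  *)
HB.mixin Record Lmodule_isBimodule (A B : pzRingType) M of GRing.Lmodule A M := {
  rscale : M -> B -> M;
  rscaleA : forall x b c, rscale (rscale x b) c = rscale x (b * c);
  rscale1 : forall x, rscale x 1 = x;
  rscaleDl : forall b, {morph rscale^~ b : x y / x + y};
  rscaleDr : forall x, {morph rscale x : b c / b + c};
  scale_rscale : forall a x b, rscale (a *: x) b = a *: rscale x b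
}.

#[short(type="bimodType")]
HB.structure Definition Bimodule (A B : pzRingType) :=
  {M of GRing.Lmodule A M & Lmodule_isBimodule A B M}.

Notation "x <*: b" := (rscale x b) (at level 40, left associativity) : ring_scope.

HB.instance Definition _ (A : pzRingType) :=
  @Lmodule_isBimodule.Build A A A^o (fun x b : A => x * b)
    (fun x b c => esym (mulrA x b c)) (@mulr1 A)
    (fun b x y => mulrDl x y b) (fun x b c => mulrDr x b c)
    (fun a x b => esym (mulrA a x b)).

Section BimoduleTheory.
Variables (A B : pzRingType) (M : bimodType A B).

Lemma rscaler0 (x : M) : x <*: (0 : B) = 0.
Proof. by apply: (addrI (x <*: 0)); rewrite -rscaleDr !addr0. Qed.

Lemma rscale0r (b : B) : (0 : M) <*: b = 0.
Proof. by apply: (addrI (0 <*: b)); rewrite -rscaleDl !addr0. Qed.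

End BimoduleTheory.

Section Tensor.
Variables (A B C : pzRingType) (M : bimodType A B) (N : bimodType B C).

Local Notation free := {freeg (M * N)%type / int}.

(* The additive subgroup of the free abelian group on M * N generated by the  *)
(* relations defining the tensor product over B.                              *)
Inductive tensor_relation : free -> Prop :=
| TensorRel0 : tensor_relation 0
| TensorRelB u v :
    tensor_relation u -> tensor_relation v -> tensor_relation (u - v)
| TensorRelDl x x' y :
    tensor_relation (<< (x + x', y) >> - << (x, y) >> - << (x', y) >>)
| TensorRelDr x y y' :
    tensor_relation (<< (x, y + y') >> - << (x, y) >> - << (x, y') >>)
| TensorRelM x b y :
    tensor_relation (<< (x <*: b, y) >> - << (x, b *: y) >>).

Definition tensor_rel : {pred free} := fun u => `[< tensor_relation u >].

Fact tensor_rel_zmod_closed : zmod_closed tensor_rel.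
Proof.
split=> [|u v /asboolP ru /asboolP rv]; apply/asboolP; first exact: TensorRel0.
exact: TensorRelB.
Qed.

HB.instance Definition _ :=
  GRing.isZmodClosed.Build free tensor_rel tensor_rel_zmod_closed.

Definition tensor := Quotient.quot tensor_rel.
HB.instance Definition _ := GRing.Zmodule.on tensor.
HB.instance Definition _ := EqQuotient.on tensor.
HB.instance Definition _ := ZmodQuotient.on tensor.

Definition tens (x : M) (y : N) : tensor := \pi_tensor << (x, y) >>.

Definition balanced (V : zmodType) (f : M -> N -> V) :=
  [/\ forall y, {morph f^~ y : x x' / x + x'},
      forall x, {morph f x : y y' / y + y'}
    & forall x b y, f (x <*: b) y = f x (b *: y)].

(* The additive map induced on the tensor product by f; it is meaningful only *)
(* when f is balanced, see tensor_lift_tens and tensor_lift_zmod.             *)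
Definition tensor_lift (V : zmodType) (f : M -> N -> V) (t : tensor) : V :=
  fglift (fun xy : M * N => f xy.1 xy.2 : zmodule V) (repr t).

Section Lift.
Variables (V : zmodType) (f : M -> N -> V).
Hypothesis bal_f : balanced f.
Let F : M * N -> zmodule V := fun xy => f xy.1 xy.2.

Let fgliftB u v : fglift F (u - v) = fglift F u - fglift F v.
Proof. exact: lift_is_additive. Qed.

Let fglift1 xy : fglift F << xy >> = F xy.
Proof. by rewrite liftU scale1r. Qed.

Lemma tensor_lift_pi u : tensor_lift f (\pi_tensor u) = fglift F u.
Proof.
have [fDl fDr fM] := bal_f.
have rel0 v : tensor_relation v -> fglift F v = 0.
  elim=> {v} [|v w _ v0 _ w0|x x' y|x y y'|x b y].
  - by rewrite -(subrr 0) fgliftB subrr.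
  - by rewrite fgliftB v0 w0 subrr.
  - by rewrite !fgliftB !fglift1 /F /= fDl (addrC (f x y)) addrK subrr.
  - by rewrite !fgliftB !fglift1 /F /= fDr (addrC (f x y)) addrK subrr.
  - by rewrite fgliftB !fglift1 /F /= fM subrr.
apply/eqP; rewrite /tensor_lift -subr_eq0 -fgliftB; apply/eqP/rel0/asboolP.
rewrite -[`[< _ >]]/(_ \in tensor_rel) Quotient.idealrBE.
by apply/eqP; rewrite reprK.
Qed.

Lemma tensor_lift_tens x y : tensor_lift f (tens x y) = f x y.
Proof. by rewrite tensor_lift_pi fglift1. Qed.

Lemma tensor_lift_zmod : zmod_morphism (tensor_lift f).
Proof.
move=> s t; rewrite -[s]reprK -[t]reprK -raddfB !tensor_lift_pi.
exact: fgliftB.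
Qed.

End Lift.

Lemma tens_balanced : balanced tens.
Proof.
have pi0 u : tensor_relation u -> \pi_tensor u = 0.
  move=> /asboolP ru; rewrite -[0](raddf0 (\pi_tensor)).
  by apply/eqP; rewrite -Quotient.idealrBE subr0.
split=> [y x x'|x y y'|x b y]; apply/eqP; rewrite -subr_eq0 ?opprD ?addrA.
- by rewrite /tens -!raddfB; apply/eqP/pi0/TensorRelDl.
- by rewrite /tens -!raddfB; apply/eqP/pi0/TensorRelDr.
- by rewrite /tens -!raddfB; apply/eqP/pi0/TensorRelM.
Qed.

Lemma tensor_ind (P : tensor -> Prop) :
    (forall x y, P (tens x y)) -> (forall s t, P s -> P t -> P (s - t)) ->
  forall t, P t.
Proof.
move=> Ptens PB t.
have P0 : P 0 by rewrite -(subrr (tens 0 0)); apply: PB.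
have PN s : P s -> P (- s) by rewrite -sub0r; apply: PB.
have PD s s' : P s -> P s' -> P (s + s').
  by move=> Ps Ps'; rewrite -[s']opprK; apply/PB/PN.
have Pn s n : P s -> P (s *+ n).
  by move=> Ps; elim: n => [|n IH]; rewrite ?mulr0n // mulrS; apply: PD.
rewrite -[t]reprK -[repr t]freeg_sumE raddf_sum.
elim/big_rec: _ => //= -[x y] s _ Ps; apply: PD => //.
rewrite -[coeff _ _]intz -freegU_mulz raddfMz.
by case: (coeff _ _) => n; [apply: Pn|apply/PN/Pn]; apply: Ptens.
Qed.

Lemma tensor_lift_unique (V : zmodType) (f g : tensor -> V) :
    zmod_morphism f -> zmod_morphism g ->
    (forall x y, f (tens x y) = g (tens x y)) ->
  f =1 g.
Proof.
move=> fB gB fg; apply: tensor_ind => [//|s t].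
by rewrite fB gB => -> ->.
Qed.

Definition tensor_scale (a : A) : tensor -> tensor :=
  tensor_lift (fun x y => tens (a *: x) y).

Definition tensor_rscale (t : tensor) (c : C) : tensor :=
  tensor_lift (fun x y => tens x (y <*: c)) t.

Fact tensor_scale_balanced a : balanced (fun x y => tens (a *: x) y).
Proof.
have [tDl tDr tM] := tens_balanced.
split=> [y x x'|x y y'|x b y]; first by rewrite /= scalerDr tDl.
  exact: tDr.
by rewrite -scale_rscale tM.
Qed.

Fact tensor_rscale_balanced c : balanced (fun x y => tens x (y <*: c)).
Proof.
have [tDl tDr tM] := tens_balanced.
split=> [y x x'|x y y'|x b y]; first exact: tDl.
  by rewrite /= rscaleDl tDr.
by rewrite tM scale_rscale.
Qed.

Lemma tensor_scaleE a x y : tensor_scale a (tens x y) = tens (a *: x) y.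
Proof. by rewrite /tensor_scale tensor_lift_tens//; apply: tensor_scale_balanced. Qed.

Lemma tensor_rscaleE x y c : tensor_rscale (tens x y) c = tens x (y <*: c).
Proof. by rewrite /tensor_rscale tensor_lift_tens//; apply: tensor_rscale_balanced. Qed.

Fact tensor_scale_zmod a : zmod_morphism (tensor_scale a).
Proof. exact/tensor_lift_zmod/tensor_scale_balanced. Qed.

Fact tensor_rscale_zmod c : zmod_morphism (tensor_rscale^~ c).
Proof. exact/tensor_lift_zmod/tensor_rscale_balanced. Qed.

Let zmodD (f : tensor -> tensor) : zmod_morphism f -> {morph f : s t / s + t}.
Proof.
move=> fB s t; have f0 : f 0 = 0 by rewrite -{1}(subrr 0) fB subrr.
have fN u : f (- u) = - f u by rewrite -[- u]sub0r fB f0 sub0r.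
by rewrite -{1}[t]opprK fB fN opprK.
Qed.

Fact tensor_scaleA a b t :
  tensor_scale a (tensor_scale b t) = tensor_scale (a * b) t.
Proof.
elim/tensor_ind: t => [x y|s t]; first by rewrite !tensor_scaleE scalerA.
by rewrite !tensor_scale_zmod => -> ->.
Qed.

Fact tensor_scale1 : left_id 1 tensor_scale.
Proof.
elim/tensor_ind=> [x y|s t]; first by rewrite tensor_scaleE scale1r.
by rewrite tensor_scale_zmod => -> ->.
Qed.

Fact tensor_scaleDr : right_distributive tensor_scale +%R.
Proof. by move=> a; apply/zmodD/tensor_scale_zmod. Qed.

Fact tensor_scaleDl t : {morph tensor_scale^~ t : a b / a + b}.
Proof.
move=> a b; have [tDl _ _] := tens_balanced; elim/tensor_ind: t => [x y|s t].
  by rewrite !tensor_scaleE scalerDl tDl.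
by rewrite !tensor_scale_zmod => -> ->; rewrite opprD addrACA.
Qed.

HB.instance Definition _ := GRing.Zmodule_isLmodule.Build A tensor
  tensor_scaleA tensor_scale1 tensor_scaleDr tensor_scaleDl.

Fact tensor_rscaleA t b c :
  tensor_rscale (tensor_rscale t b) c = tensor_rscale t (b * c).
Proof.
elim/tensor_ind: t => [x y|s t]; first by rewrite !tensor_rscaleE rscaleA.
by rewrite !tensor_rscale_zmod => -> ->.
Qed.

Fact tensor_rscale1 t : tensor_rscale t 1 = t.
Proof.
elim/tensor_ind: t => [x y|s t]; first by rewrite tensor_rscaleE rscale1.
by rewrite tensor_rscale_zmod => -> ->.
Qed.

Fact tensor_rscaleDl c : {morph tensor_rscale^~ c : s t / s + t}.
Proof. exact/zmodD/tensor_rscale_zmod. Qed.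

Fact tensor_rscaleDr t : {morph tensor_rscale t : b c / b + c}.
Proof.
move=> b c; have [_ tDr _] := tens_balanced; elim/tensor_ind: t => [x y|s t].
  by rewrite !tensor_rscaleE rscaleDr tDr.
by rewrite !tensor_rscale_zmod => -> ->; rewrite opprD addrACA.
Qed.

Fact tensor_scale_rscale (a : A) (t : tensor) (c : C) :
  tensor_rscale (a *: t) c = a *: tensor_rscale t c.
Proof.
rewrite -![_ *: _]/(tensor_scale _ _).
elim/tensor_ind: t => [x y|s t].
  by rewrite !(tensor_scaleE, tensor_rscaleE).
by rewrite !(tensor_scale_zmod, tensor_rscale_zmod) => -> ->.
Qed.

HB.instance Definition _ := @Lmodule_isBimodule.Build A C tensor tensor_rscale
  tensor_rscaleA tensor_rscale1 tensor_rscaleDl tensor_rscaleDr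
  tensor_scale_rscale.

Lemma tensDl x x' y : tens (x + x') y = tens x y + tens x' y.
Proof. by have [-> _ _] := tens_balanced. Qed.

Lemma tensDr x y y' : tens x (y + y') = tens x y + tens x y'.
Proof. by have [_ -> _] := tens_balanced. Qed.

Lemma tensM x b y : tens (x <*: b) y = tens x (b *: y).
Proof. by have [_ _ ->] := tens_balanced. Qed.

Lemma tens0l y : tens 0 y = 0.
Proof. by apply: (addrI (tens 0 y)); rewrite -tensDl !addr0. Qed.

Lemma tens0r x : tens x 0 = 0.
Proof. by apply: (addrI (tens x 0)); rewrite -tensDr !addr0. Qed.

Lemma scale_tens (a : A) x y : a *: tens x y = tens (a *: x) y.
Proof. exact: tensor_scaleE. Qed.

Lemma rscale_tens x y (c : C) : tens x y <*: c = tens x (y <*: c).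
Proof. exact: tensor_rscaleE. Qed.

End Tensor.

(* S as an S-R-bimodule, resp. an R-S-bimodule: the bimodule structures are   *)
(* attached to two distinct names of the carrier of S.                        *)
Definition ext_right (S : pzRingType) (P : {pred S}) (R : subPzRingType P) : Type := S.
Definition ext_left (S : pzRingType) (P : {pred S}) (R : subPzRingType P) : Type := S.

Section Separable.
Variables (S : pzRingType) (P : {pred S}) (R : subPzRingType P).

Local Notation SR := (ext_right R).
Local Notation RS := (ext_left R).

HB.instance Definition _ := GRing.Zmodule.copy SR S.
HB.instance Definition _ := GRing.Zmodule.copy RS S.

HB.instance Definition _ := @GRing.Zmodule_isLmodule.Build S SR
  (fun s x : S => s * x)
  (fun a b v => mulrA a b v) (@mul1r S)
  (fun a x y => mulrDr a x y) (fun v a b => mulrDl a b v).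

Fact ext_rightA (x : S) (b c : R) : x * val b * val c = x * val (b * c).
Proof. by rewrite rmorphM mulrA. Qed.
Fact ext_right1 (x : S) : x * val (1 : R) = x.
Proof. by rewrite rmorph1 mulr1. Qed.
Fact ext_rightDr (x : S) : {morph (fun b : R => x * val b) : b c / b + c}.
Proof. by move=> b c; rewrite rmorphD mulrDr. Qed.

HB.instance Definition _ := @Lmodule_isBimodule.Build S R SR
  (fun (x : S) (r : R) => x * val r)
  ext_rightA ext_right1 (fun b x y => mulrDl x y (val b)) ext_rightDr
  (fun a x b => esym (mulrA a x (val b))).

Fact ext_leftA (a b : R) (x : S) : val a * (val b * x) = val (a * b) * x.
Proof. by rewrite rmorphM mulrA. Qed.
Fact ext_left1 (x : S) : val (1 : R) * x = x.
Proof. by rewrite rmorph1 mul1r. Qed.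
Fact ext_leftDl (x : S) : {morph (fun b : R => val b * x) : b c / b + c}.
Proof. by move=> b c; rewrite rmorphD mulrDl. Qed.

HB.instance Definition _ := @GRing.Zmodule_isLmodule.Build R RS
  (fun (r : R) (x : S) => val r * x)
  ext_leftA ext_left1 (fun a x y => mulrDr (val a) x y) ext_leftDl.

HB.instance Definition _ := @Lmodule_isBimodule.Build R S RS
  (fun x b : S => x * b)
  (fun x b c => esym (mulrA x b c)) (@mulr1 S)
  (fun b x y => mulrDl x y b) (fun x b c => mulrDr x b c)
  (fun a x b => esym (mulrA (val a) x b)).

Definition ext_tensor : bimodType S S := tensor SR RS.

Definition ext_mul (x : SR) (y : RS) : S := (x : S) * (y : S).

Fact ext_mul_balanced : balanced ext_mul.
Proof.
split=> [y x x'|x y y'|x b y]; first exact: mulrDl.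
  exact: mulrDr.
exact/esym/mulrA.
Qed.

Definition mult_map : ext_tensor -> S := tensor_lift ext_mul.

Lemma mult_map_tens (x : SR) (y : RS) :
  mult_map (tens x y) = (x : S) * (y : S).
Proof. by rewrite /mult_map tensor_lift_tens //; apply: ext_mul_balanced. Qed.

Lemma mult_map_zmod : zmod_morphism mult_map.
Proof. exact/tensor_lift_zmod/ext_mul_balanced. Qed.

Definition separable_extension :=
  exists x : ext_tensor, mult_map x = 1 /\ forall s : S, s *: x = x <*: s.

End Separable.

Arguments separable_extension {S P} R.

Record moritaContext (A B : pzRingType) := MoritaContext {
  morita_M : bimodType A B;
  morita_N : bimodType B A;
  morita_phi : {linear tensor morita_M morita_N -> A^o};
  morita_psi : {linear tensor morita_N morita_M -> B^o};
  morita_phi_rscale : forall t (a : A),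
    morita_phi (t <*: a) = morita_phi t <*: a;
  morita_psi_rscale : forall t (b : B),
    morita_psi (t <*: b) = morita_psi t <*: b;
  morita_assocM : forall (m : morita_M) (n : morita_N) (m' : morita_M),
    (morita_phi (tens m n) : A) *: m' = m <*: (morita_psi (tens n m') : B);
  morita_assocN : forall (n : morita_N) (m : morita_M) (n' : morita_N),
    (morita_psi (tens n m) : B) *: n' = n <*: (morita_phi (tens m n') : A)
}.

(* The epimorphisms of bimodules are the surjective homomorphisms. *)
Definition morita_strict (A B : pzRingType) (K : moritaContext A B) :=
  (forall a : A, exists t, morita_phi K t = a) /\
  (forall b : B, exists t, morita_psi K t = b).

Section MoritaRing.
Variables (A B : pzRingType) (K : moritaContext A B).
Local Notation M := (morita_M K).
Local Notation N := (morita_N K).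
Local Notation phi := (morita_phi K).
Local Notation psi := (morita_psi K).

(* ((a, m), (n, b)) is the matrix with rows (a, m) and (n, b); the additive   *)
(* structure is the componentwise one of the product.                         *)
Definition morita_ring : Type := ((A * M) * (N * B))%type.
HB.instance Definition _ := GRing.Zmodule.on morita_ring.

Definition morita_mul (s t : morita_ring) : morita_ring :=
  let: ((a1, m1), (n1, b1)) := s in
  let: ((a2, m2), (n2, b2)) := t in
  ((a1 * a2 + phi (tens m1 n2), a1 *: m2 + m1 <*: b2),
   (n1 <*: a2 + b1 *: n2, psi (tens n1 m2) + b1 * b2)).

Definition morita_one : morita_ring := ((1, 0), (0, 1)).

Let phil (a : A) (m : M) (n : N) : a * phi (tens m n) = phi (tens (a *: m) n).
Proof. by rewrite -scale_tens linearZ. Qed.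
Let phir (a : A) (m : M) (n : N) : phi (tens m n) * a = phi (tens m (n <*: a)).
Proof. by rewrite -rscale_tens morita_phi_rscale. Qed.
Let psil (b : B) (n : N) (m : M) : b * psi (tens n m) = psi (tens (b *: n) m).
Proof. by rewrite -scale_tens linearZ. Qed.
Let psir (b : B) (n : N) (m : M) : psi (tens n m) * b = psi (tens n (m <*: b)).
Proof. by rewrite -rscale_tens morita_psi_rscale. Qed.

Fact morita_mulA : associative morita_mul.
Proof.
move=> [[a1 m1] [n1 b1]] [[a2 m2] [n2 b2]] [[a3 m3] [n3 b3]] /=.
congr (_, _); congr (_, _).
- rewrite mulrDr mulrDl phil phir tensDr tensDl !linearD /= tensM mulrA.
  by rewrite -!addrA; congr (_ + _); rewrite addrCA.
- rewrite scalerDr scalerDl rscaleDr rscaleDl morita_assocM !scalerA !rscaleA.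
  by rewrite scale_rscale -!addrA; congr (_ + _); rewrite addrCA.
- rewrite scalerDr scalerDl rscaleDr rscaleDl -morita_assocN !scalerA !rscaleA.
  by rewrite scale_rscale -!addrA; congr (_ + _); rewrite addrCA.
- rewrite mulrDr mulrDl psil psir tensDr tensDl !linearD /= tensM mulrA.
  by rewrite -!addrA; congr (_ + _); rewrite addrCA.
Qed.

Fact morita_mul1r : left_id morita_one morita_mul.
Proof.
move=> [[a m] [n b]] /=.
by rewrite !mul1r !scale1r !rscale0r !tens0l !linear0 !addr0 !add0r.
Qed.

Fact morita_mulr1 : right_id morita_one morita_mul.
Proof.
move=> [[a m] [n b]] /=.
by rewrite !mulr1 !rscale1 !scaler0 !tens0r !linear0 !addr0 !add0r.
Qed.

Fact morita_mulDl : left_distributive morita_mul +%R.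
Proof.
move=> [[a1 m1] [n1 b1]] [[a2 m2] [n2 b2]] [[a3 m3] [n3 b3]] /=.
by congr (_, _); congr (_, _);
  rewrite ?mulrDl ?scalerDl ?rscaleDl ?tensDl ?linearD /= addrACA.
Qed.

Fact morita_mulDr : right_distributive morita_mul +%R.
Proof.
move=> [[a1 m1] [n1 b1]] [[a2 m2] [n2 b2]] [[a3 m3] [n3 b3]] /=.
by congr (_, _); congr (_, _);
  rewrite ?mulrDr ?scalerDr ?rscaleDr ?tensDr ?linearD /= addrACA.
Qed.

HB.instance Definition _ := GRing.Zmodule_isPzRing.Build morita_ring
  morita_mulA morita_mul1r morita_mulr1 morita_mulDl morita_mulDr.

Definition morita_diag : {pred morita_ring} :=
  fun s => (s.1.2 == 0) && (s.2.1 == 0).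

Fact morita_diag_subring_closed : subring_closed morita_diag.
Proof.
split; first by rewrite unfold_in /= !eqxx.
  move=> [[a m] [n b]] [[a' m'] [n' b']] /andP[/= /eqP-> /eqP->].
  by move=> /andP[/= /eqP-> /eqP->]; rewrite unfold_in /= !subrr !eqxx.
move=> [[a m] [n b]] [[a' m'] [n' b']] /andP[/= /eqP-> /eqP->].
move=> /andP[/= /eqP-> /eqP->].
by rewrite unfold_in /= !scaler0 !rscale0r !addr0 !eqxx.
Qed.

HB.instance Definition _ :=
  GRing.isSubringClosed.Build morita_ring morita_diag morita_diag_subring_closed.

Definition diag_ring : Type := {s : morita_ring | s \in morita_diag}.
HB.instance Definition _ := SubChoice.on diag_ring.
HB.instance Definition _ := GRing.SubChoice_isSubPzRing.Build morita_ring
  morita_diag diag_ring morita_diag_subring_closed.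

End MoritaRing.

(* Main.v *)
From HB Require Import structures.
Require Import Defs.
From mathcomp Require Import all_boot all_algebra.

(** Let [e] be the idempotent of the Morita ring [S] with a [1] in the corner
    [A].  Since the pairing [N (x) M -> B] is onto, the unit of [B] is a finite
    sum of values [psi (n (x) m)], and therefore
    [1 = e * e + \sum E21(n) * E12(m)] in [S]; that is, [e] is a full
    idempotent, [S e S = S].  Moreover the corner [e S e] is a copy of [A],
    hence lies in the diagonal ring [R].

    A full idempotent whose corner lies in [R] always gives separability.  Write
    [1 = \sum_i u i * v i] with [u i] in [S e] and [v i] in [e S], and put
    [x = \sum_i u i (x) v i].  This [x] is mapped to [1] by multiplication.
    For [s] in [S], inserting [1 = \sum_i u i * v i] to the left of [s * u j]
    in [s x], and to the right of [v i * s] in [x s], gives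
    [s x = \sum_(i, j) u i * (v i * s * u j) (x) v j] and
    [x s = \sum_(i, j) u i (x) (v i * s * u j) * v j].  The two sums agree
    because the scalars [v i * s * u j], elements of [e S e], can be moved across
    the tensor sign.  This is
    [separable_of_decomposition], in which [e] enters only through the condition
    that every [v i * s * u j] is in [R]. *)

Set Implicit Arguments.
Unset Strict Implicit.
Unset Printing Implicit Defensive.

Import GRing.Theory.
Local Open Scope ring_scope.

Section TensorSums.
Variables (A B C : pzRingType) (M : bimodType A B) (N : bimodType B C).

Lemma tens_suml I (r : seq I) (u : I -> M) (y : N) :
  tens (\sum_(i <- r) u i) y = \sum_(i <- r) tens (u i) y.
Proof.
exact: (big_morph (fun x => tens x y) (fun x x' => tensDl x x' y) (tens0l M y)).
Qed.

Lemma tens_sumr I (r : seq I) (x : M) (v : I -> N) :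
  tens x (\sum_(i <- r) v i) = \sum_(i <- r) tens x (v i).
Proof. exact: (big_morph (tens x) (tensDr x) (tens0r N x)). Qed.

(** No integer coefficients are needed because [- tens x y = tens (- x) y]. *)
Lemma tensor_sum_tens (t : tensor M N) :
  exists r : seq (M * N), t = \sum_(p <- r) tens p.1 p.2.
Proof.
have tensN (x : M) (y : N) : - tens x y = tens (- x) y.
  by apply/esym/eqP; rewrite -addr_eq0 -tensDl addNr tens0l.
elim/tensor_ind: t => [x y|_ _ [r ->] [r' ->]].
  by exists [:: (x, y)]; rewrite big_seq1.
exists (r ++ [seq (- p.1, p.2) | p <- r']).
rewrite big_cat big_map -sumrN; congr (_ + _).
by apply: eq_bigr => p _; rewrite tensN.
Qed.

End TensorSums.

Lemma rscale_suml (A B : pzRingType) (M : bimodType A B) I (r : seq I)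
    (u : I -> M) (b : B) :
  (\sum_(i <- r) u i) <*: b = \sum_(i <- r) u i <*: b.
Proof.
exact: (big_morph (fun x => x <*: b) (rscaleDl b) (rscale0r M b)).
Qed.

HB.instance Definition _ (S : pzRingType) (P : {pred S}) (R : subPzRingType P) :=
  GRing.isZmodMorphism.Build (ext_tensor R) S (@mult_map S P R)
    (@mult_map_zmod S P R).

(** The element [\sum_i u i (x) v i] commutes with [s] because the scalars
    [v i * s * u j] can be moved across the tensor sign. *)
Lemma separable_of_decomposition (S : pzRingType) (P : {pred S})
    (R : subPzRingType P) I (r : seq I) (u v : I -> S) :
    \sum_(i <- r) u i * v i = 1 ->
    (forall i j s, v i * s * u j \in P) ->
  separable_extension R.
Proof.
move=> uv1 vsuP.
pose x : ext_tensor R :=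
  \sum_(i <- r) tens (u i : ext_right R) (v i : ext_left R).
have slide (s : S) i j :
    tens (u i * (v i * s * u j) : ext_right R) (v j : ext_left R)
  = tens (u i : ext_right R) (v i * s * u j * v j : ext_left R).
  have := tensM (u i : ext_right R) (@Sub S P R _ (vsuP i j s))
                (v j : ext_left R).
  by rewrite /rscale /GRing.scale /= !SubK.
exists x; split=> [|s].
  rewrite raddf_sum -[RHS]uv1.
  by apply: eq_bigr => i _; exact: mult_map_tens.
have sxE : s *: x
    = \sum_(j <- r) \sum_(i <- r)
        tens (u i * (v i * s * u j) : ext_right R) (v j : ext_left R).
  rewrite scaler_sumr; apply: eq_bigr => j _.
  rewrite scale_tens -tens_suml; congr tens.
  rewrite -[LHS](mul1r (s * u j)) -uv1 mulr_suml.
  by apply: eq_bigr => i _; rewrite !mulrA.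
have xsE : x <*: s
    = \sum_(i <- r) \sum_(j <- r)
        tens (u i : ext_right R) (v i * s * u j * v j : ext_left R).
  rewrite rscale_suml; apply: eq_bigr => i _.
  rewrite rscale_tens -tens_sumr; congr tens.
  rewrite -[LHS](mulr1 (v i * s)) -uv1 mulr_sumr.
  by apply: eq_bigr => j _; rewrite !mulrA.
rewrite sxE xsE exchange_big; apply: eq_bigr => i _.
by apply: eq_bigr => j _; apply: slide.
Qed.

Section MoritaCorner.
Variables (A B : pzRingType) (K : moritaContext A B).
Local Notation S := (morita_ring K).

(** The general elements of [S e] and of [e S]. *)
Definition morita_col (a : A) (n : morita_N K) : S := ((a, 0), (n, 0)).
Definition morita_row (a : A) (m : morita_M K) : S := ((a, m), (0, 0)).

Lemma morita_col_row a n a' m :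
  morita_col a n * morita_row a' m
  = ((a * a', a *: m), (n <*: a', morita_psi K (tens n m))) :> S.
Proof.
rewrite -[LHS]/(morita_mul _ _) /=.
by rewrite tens0l linear0 rscale0r scale0r mul0r !addr0.
Qed.

(** The product lies in [e S * S * S e = e S e], the copy of [A] in [S]. *)
Lemma morita_row_col_diag a m (s : S) a' n :
  morita_row a m * s * morita_col a' n \in @morita_diag A B K.
Proof.
case: s => [[b m'] [n' c]].
rewrite -[_ * _]/(morita_mul (morita_mul _ _) _) unfold_in /=.
rewrite !rscaler0 !scaler0 addr0 eqxx /= rscale0r scale0r tens0l linear0 mul0r.
by rewrite !addr0 rscale0r scale0r addr0.
Qed.

End MoritaCorner.

Theorem proposition42 (A B : pzRingType) (K : moritaContext A B)
    (strictK : morita_strict K) :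
  separable_extension (diag_ring K).
Proof.
have [_ /(_ 1)[t psi_t]] := strictK.
have [r tE] := tensor_sum_tens t.
(* The index None carries the term e * e, and the index Some (n, m) the term
   E21(n) * E12(m). *)
pose u (i : option (morita_N K * morita_M K)) : morita_ring K :=
  if i is Some p then morita_col 0 p.1 else morita_col 1 0.
pose v (i : option (morita_N K * morita_M K)) : morita_ring K :=
  if i is Some p then morita_row 0 p.2 else morita_row 1 0.
apply: (@separable_of_decomposition _ _ (diag_ring K) _
          (None :: map some r) u v) => [|i j s]; last first.
  by case: i => [p|]; case: j => [q|]; apply: morita_row_col_diag.
pose f22 (b : B) : morita_ring K := ((0, 0), (0, b)).
have f22D : {morph f22 : b c / b + c}.
  by move=> b c; congr (_, _); congr (_, _); rewrite addr0.
have sum_f22 : \sum_(p <- r) morita_col 0 p.1 * morita_row 0 p.2 = f22 1.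
  rewrite -psi_t tE linear_sum (big_morph f22 f22D (erefl _)).
  by apply: eq_bigr => p _; rewrite morita_col_row mul0r scale0r rscaler0.
rewrite big_cons big_map sum_f22 morita_col_row.
rewrite mul1r scale1r rscale0r tens0l linear0.
by congr (_, _); congr (_, _); rewrite ?addr0 ?add0r.
Qed.
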